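(* A triplet $(f,e,\alpha) \in \mathcal{S}^-(\Delta_\xi, r)$, $e = (e_1,e_2)$, has anchored pair $(f,e)$ if and only if $e_1 < e_2$ and $$(\mathbf{1}_\alpha)_i = 0 \quad \text{for all } i < e_1.$$
   Context: $D \ge 1$ and $r \ge 1$ are integers and $\Delta_\xi$ is a non-degenerate $D$-simplex in $\mathbb{R}^D$ with vertex labels $0,\dots,D$, naturally ordered. A face is identified with its label set $f \subseteq\{0,\dots,D\}$; $\dim f = |f|-1$, $\min f$ is the smallest label. For $\alpha \in \mathbb{N}_0^{D+1}$, $|\alpha| = \sum_i\alpha_i$, $\operatorname{supp}(\alpha) = \{i : \alpha_i > 0\}$, and $\mathbf{1}_\alpha\in\{0,1\}^{D+1}$ has $(\mathbf{1}_\alpha)_i = 1$ iff $\alpha_i > 0$. $\mathcal{S}^-(\Delta_\xi, r)$ is the set of triplets $(f,e,\alpha)$ with $\dim f\ge 1$, $e = (e_1,e_2)$ an ordered pair of labels of $f$ with $e_1\ne e_2$ (no order between $e_1$ and $e_2$ is imposed), $|\alpha| = r-1$ and $\operatorname{supp}(\alpha)\cup\{e_1,e_2\} = f$. A pair $(f,e)$ is anchored if $e_1 < e_2$ and $e_1 = \min f$. *)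

(* Defs.v *)
From HB Require Import structures.
From mathcomp Require Import all_boot all_order all_algebra.
From mathcomp Require Import reals.
Set Implicit Arguments.
Unset Strict Implicit.
Unset Printing Implicit Defensive.
Import Order.TTheory GRing.Theory.

(* Vertices are labelled by 'I_D.+1 with its natural order; non-degeneracy is
   linear independence of the D edge vectors issued from vertex 0. *)
Record simplex (R : realType) (D : nat) := Simplex {
  vertex : 'I_D.+1 -> 'rV[R]_D;
  vertex_nondegenerate :
    row_free (\matrix_(i < D) (vertex (lift ord0 i) - vertex ord0)%R) }.

Section Labels.
Variable D : nat.
Implicit Types (f : {set 'I_D.+1}) (e : 'I_D.+1 * 'I_D.+1)
  (alpha : {ffun 'I_D.+1 -> nat}).

(* The truncated predecessor gives the empty set dimension 0 instead of -1;
   only dim f >= 1 is ever tested. *)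
Definition dim f : nat := #|f|.-1.

(* The smallest label of f when f is nonempty, the last label D otherwise. *)
Definition min_label f : 'I_D.+1 := \big[Order.min/ord_max]_(i in f) i.

Definition mi_size alpha : nat := \sum_i alpha i.

Definition mi_supp alpha : {set 'I_D.+1} := [set i | 0 < alpha i].

Definition mi_ind alpha : {ffun 'I_D.+1 -> nat} :=
  [ffun i => if 0 < alpha i then 1 else 0].

Definition anchored f e : bool := (e.1 < e.2) && (e.1 == min_label f).

Definition triplet : Type :=
  ({set 'I_D.+1} * ('I_D.+1 * 'I_D.+1) * {ffun 'I_D.+1 -> nat})%type.

End Labels.

(* Only the labels of Delta enter the definition, not the vertex positions. *)
Definition Sminus (R : realType) (D : nat) (Delta : simplex R D) (r : nat) :
    {pred triplet D} :=
  [pred t : triplet D |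
    let: (f, e, alpha) := t in
    [&& 1 <= dim f,
        e.1 \in f, e.2 \in f, e.1 != e.2,
        mi_size alpha == r - 1
      & mi_supp alpha :|: [set e.1; e.2] == f]].

Lemma min_labelP (D : nat) (f : {set 'I_D.+1}) : f != set0 ->
  min_label f \in f /\ forall i, i \in f -> min_label f <= i.
Proof.
move=> /set0Pn[x xf]; split.
  rewrite /min_label (bigmin_eq_arg _ x) //; last by move=> *; apply: leq_ord.
  by case: arg_minP.
by move=> i fi; apply: (@bigmin_le_cond _ _ _ _ _ (mem f) id).
Qed.

(* Main.v *)
Require Import Defs.
From HB Require Import structures.
From mathcomp Require Import all_boot all_order all_algebra.
From mathcomp Require Import reals.

(** As [f] is the union of the support of [alpha] and {[e1], [e2]}, once [e1 < e2] any label of [f]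
    below [e1] must come from the support. Since [e1] is in [f], it is the minimum exactly when the
    support has no label below it. *)

Theorem theorem9 (R : realType) (D r : nat) (hD : 1 <= D) (hr : 1 <= r)
    (Delta : simplex R D) (f : {set 'I_D.+1}) (e1 e2 : 'I_D.+1)
    (alpha : {ffun 'I_D.+1 -> nat}) :
  (f, (e1, e2), alpha) \in Sminus Delta r ->
  (anchored f (e1, e2) <->
   e1 < e2 /\ (forall i : 'I_D.+1, i < e1 -> mi_ind alpha i = 0)).
Proof.
case/and5P=> _ /= e1f _ _ /andP[_ /eqP deff].
have [minf le_min] : min_label f \in f /\ forall i, i \in f -> min_label f <= i.
  by apply: min_labelP; apply/set0Pn; exists e1.
split=> [/andP[/= lt12 /eqP e1min]|[lt12 ind0]].
  split=> // i lt_i_e1; rewrite ffunE; case: ifP => // alpha_i.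
  have /le_min : i \in f by rewrite -deff !inE alpha_i.
  by rewrite -e1min leqNgt lt_i_e1.
(* Minimality gives one inequality; it remains to refute [min_label f < e1]. *)
rewrite /anchored /= lt12 -val_eqE eqn_leq /= (le_min _ e1f) andbT leqNgt.
apply/negP=> lt_min_e1; have := ind0 _ lt_min_e1; rewrite ffunE.
(* The minimum is outside the support, so it would have to be [e1] or [e2], yet it lies strictly
   below both. *)
case: ifPn => // alpha_min _; move: minf; rewrite -{2}deff !inE (negPf alpha_min) /=.
rewrite -!val_eqE /= (ltn_eqF lt_min_e1).
by rewrite (ltn_eqF (ltn_trans lt_min_e1 lt12)).
Qed.
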